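(* Let $B_1$ and $B_2$ be two $d\times d$ Hurwitz matrices, assumed to share a common, but not necessarily strict, Lyapunov matrix $P$; that is, $P$ is symmetric positive definite and $B_i^TP+PB_i\le 0$ for $i=1,2$. Then the switched system $\dot x=B_{u(t)}x$ is asymptotically stable for any input $u$ as soon as $$\mathcal{K}_1\cap\mathcal{K}_2=\{0\},$$ where $\mathcal{K}_i=\ker\left((PB_iP^{-1})^T+PB_iP^{-1}\right)$ for $i=1,2$.
   Context: Matrices are real, and $B^T$ is the transpose of $B$. For a symmetric matrix $Q$, $Q\le 0$ means $x^TQx\le 0$ for all $x\in\mathbb{R}^d$. A matrix is Hurwitz if all its eigenvalues have negative real part. An input (switching signal) is a piecewise constant, right-continuous function $u:[0,+\infty[\to\{1,2\}$, with switching times $(a_n)_{n\ge0}$, $a_0=0$, strictly increasing to $+\infty$; $u$ is constant, equal to $u_n$, on $[a_n,a_{n+1}[$, and $\delta_n=a_{n+1}-a_n$. The solution of $\dot x=B_{u(t)}x$ from the initial condition $x$ is $t\mapsto\Phi_u(t)x$, where $\Phi_u(t)=\exp((t-a_n)B_{u_n})\exp(\delta_{n-1}B_{u_{n-1}})\cdots\exp(\delta_0B_{u_0})$ for $t\in[a_n,a_{n+1}[$. The system is asymptotically stable for the input $u$ if $\Phi_u(t)x\to0$ as $t\to+\infty$ for every $x\in\mathbb{R}^d$.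
   Formalization: The sets K_i are taken as the kernel of (S B_i S^{-1})^T + S B_i S^{-1} with S = P^{1/2}, the positive definite square root of P, instead of P B_i P^{-1}; with P itself the claim is false (e.g. P = diag(1,4), B_1 = [-1,-1;1/4,0], B_2 = [-1,1;-1/4,0]). *)

(* Defs.v *)
From HB Require Import structures.
From mathcomp Require Import all_boot all_order all_algebra.
From mathcomp Require Import all_classical all_reals all_analysis.
From mathcomp Require Import complex.

Set Implicit Arguments.
Unset Strict Implicit.
Unset Printing Implicit Defensive.

Import Order.TTheory GRing.Theory Num.Theory.
Import numFieldNormedType.Exports.

Local Open Scope classical_set_scope.
Local Open Scope ring_scope.

Section LinearAlgebra.
Variables (R : realType) (d : nat).
Implicit Types A B P Q S : 'M[R]_d.

Definition quad_form Q (x : 'cV[R]_d) : R := (x^T *m Q *m x) 0 0.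

Definition mx_npos Q : Prop := forall x : 'cV[R]_d, quad_form Q x <= 0.

Definition symmetric_posdef P : Prop :=
  P^T = P /\ forall x : 'cV[R]_d, x != 0 -> 0 < quad_form P x.

Definition Hurwitz B : Prop :=
  forall z : R[i], eigenvalue (map_mx (real_complex R) B) z -> complex.Re z < 0.

Definition weak_Lyapunov P B : Prop := mx_npos (B^T *m P + P *m B).

Definition ker_col Q : set 'cV[R]_d := [set x | Q *m x = 0].

Definition is_sqrtmx P S : Prop := symmetric_posdef S /\ S *m S = P.

(* The set K_i of the theorem, to be used with S = P^{1/2}.  In the coordinates
   y = S x the Lyapunov function x^T P x becomes |y|^2, the system x' = B x
   becomes y' = S B S^{-1} y, and K_i is the set of the y at which the time
   derivative of |y|^2 vanishes.

   Taking S = P here instead of S = P^{1/2} makes the stability theorem false.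
   Take d = 2, P = diag(1, 4) and the matrices (given by rows)
     B1 = [-1, -1; 1/4, 0]      B2 = [-1, 1; -1/4, 0].
   Their only eigenvalue is -1/2, and Bi^T P + P Bi = diag(-2, 0) for both;
   P Bi P^{-1} + (P Bi P^{-1})^T = [-2, c; c, 0] with c = +-3/4 is invertible,
   so both kernels would be {0}.  Yet, with D = diag(1, 2) = P^{1/2}, every
   D exp(h B2) exp(h B1) D^{-1} (h >= 0) equals
     exp(-h) [1 - h + h^2/2, h^2/2; h^2/2, 1 + h + h^2/2],
   whose entries are nonnegative and whose last one is >= 1 - h^2.  For the
   input applying B1 then B2 during h_n = 1/(n+2) each, n = 0, 1, ..., the
   solution from x = (0, 1/2), i.e. y = D x = (0, 1), keeps y_2 >= 1/2 at the end
   of each pair, since the partial products of 1 - h_n^2 decrease to 1/2. *)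
Definition Lyapunov_kernel S B : set 'cV[R]_d :=
  ker_col ((S *m B *m invmx S)^T + S *m B *m invmx S).

Definition expmx A : 'M[R]_d := limn (series (fun k => k`!%:R^-1 *: A ^+ k)).

End LinearAlgebra.

(* A switching signal with values in {1, 2}, encoded as 'I_2 = {0, 1}, together
   with its switching times.  Consecutive modes may coincide, so that constant
   signals are allowed.  Values of the signal at negative times are irrelevant. *)
Record input (R : realType) := Input {
  signal :> R -> 'I_2;
  switch_time : nat -> R;
  switch_time0 : switch_time 0%N = 0;
  switch_time_lt : forall n, switch_time n < switch_time n.+1;
  switch_time_cvg : switch_time n @[n --> \oo] --> +oo;
  signal_const : forall n t, switch_time n <= t < switch_time n.+1 ->
    signal t = signal (switch_time n)
}.

Section SwitchedSystem.
Variables (R : realType) (d : nat) (B1 B2 : 'M[R]_d) (u : input R).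

Definition mode_mx (i : 'I_2) : 'M[R]_d := if i == ord0 then B1 else B2.

Definition dwell n : R := switch_time u n.+1 - switch_time u n.

(* The mode u_n. *)
Definition mode n : 'I_2 := u (switch_time u n).

Fixpoint Phi_switch n : 'M[R]_d :=
  if n is m.+1
  then expmx (dwell m *: mode_mx (mode m)) *m Phi_switch m
  else 1%:M.

(* For t >= 0, the unique n with a_n <= t < a_{n+1}. *)
Definition switch_index (t : R) : nat :=
  xget 0%N [set n | switch_time u n <= t < switch_time u n.+1].

Definition Phi (t : R) : 'M[R]_d :=
  let n := switch_index t in
  expmx ((t - switch_time u n) *: mode_mx (mode n)) *m Phi_switch n.

Definition asymptotically_stable : Prop :=
  forall x : 'cV[R]_d, Phi t *m x @[t --> +oo] --> (0 : 'cV[R]_d).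

End SwitchedSystem.

(* Main.v *)
From HB Require Import structures.
Require Import Defs.
From mathcomp Require Import all_boot all_order all_algebra.
From mathcomp Require Import all_classical all_reals all_analysis.
From mathcomp Require Import complex ring lra.

Set Implicit Arguments.
Unset Strict Implicit.
Unset Printing Implicit Defensive.

Import Order.TTheory GRing.Theory Num.Theory.
Import numFieldNormedType.Exports.

Local Open Scope classical_set_scope.
Local Open Scope ring_scope.

(** The hypotheses yield one function W, positive away from 0 and homogeneous of
    degree 2, that decreases strictly along both linear flows.  Then W decays
    like exp (- k t) with the same k for the two flows, hence along every
    concatenation of their pieces, however fast the switching; asymptotic
    stability for every input follows, and in fact it is exponential.

    To find W, write V x for x^T P x and q_i x >= 0 for minus the derivative of
    V along the flow of B_i (q_i is the quadratic form of - (B_i^T P + P B_i)).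
    In the coordinates y = S x the form q_i vanishes exactly on K_i, so that the
    hypothesis on the kernels says that q_1 and q_2 have no common zero except
    0.  Three facts are combined.

    - As B_i is Hurwitz, the Lyapunov equation B_i^T H_i + H_i B_i = - 1 has a
      solution H_i (Hurwitz_lyapunov_eq): B_i^T and - B_i have no common
      eigenvalue, so that H |-> B_i^T H + H B_i is injective by the
      Cayley-Hamilton theorem.  Write V_i for the quadratic form of H_i; its
      derivative in mode i is - |x|^2.

    - Let theta = q_2 / (q_1 + q_2) and U = theta V_1 + (1 - theta) V_2 (the
      function blend below).  Where q_1 vanishes, theta = 1; since q_1 and q_2
      are nonnegative, all the derivatives of q_1, and thus those of theta,
      vanish there as well.  Hence, on the zeros of q_1, the derivative of U in
      mode 1 is that of V_1, that is - |x|^2 < 0.  Symmetrically, the derivative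
      of U in mode 2 is negative on the zeros of q_2.

    - Let W = K V + U.  Its derivative in mode i is - K q_i plus that of U.  The
      second term is negative where q_i vanishes, and for K large the first one
      prevails elsewhere: this is the lemma domination, a compactness argument
      on the unit sphere.  For K large W is also positive.

    The same lemma then turns the pointwise inequalities W > 0 and W' < 0 into
    |x|^2 <= C W and W' <= - k W, and integrating the latter on each interval
    between two switching times gives the decay. *)

(** * The Lyapunov equation of a Hurwitz matrix *)

Lemma horner_mx_intertwine (F : comNzRingType) n (A B X : 'M[F]_n.+1) p :
  A *m X = X *m B -> horner_mx A p *m X = X *m horner_mx B p.
Proof.
move=> AX; elim/poly_ind: p => [|p c IH].
  by rewrite !rmorph0 mul0mx mulmx0.
rewrite !rmorphD !rmorphM /= !horner_mx_X !horner_mx_C.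
by rewrite mulmxDl mulmxDr -!mulmxE -mulmxA AX mulmxA IH mulmxA scalar_mxC.
Qed.

(** The characteristic polynomial p of A kills A, hence X p(B) = p(A) X = 0,
    while the Bezout relation between p and the characteristic polynomial of B,
    which kills B, makes p(B) invertible. *)
Lemma sylvester_inj (F : fieldType) n (A B X : 'M[F]_n) :
  coprimep (char_poly A) (char_poly B) -> A *m X = X *m B -> X = 0.
Proof.
case: n A B X => [|n] A B X; first by rewrite (flatmx0 X).
move=> /Pdiv.Field.Bezout_coprimepP [[u v]] /= /eqpP [] [a b] /=.
move=> /andP[a0 b0] uv AX.
have XA0 := horner_mx_intertwine (char_poly A) AX.
move: XA0; rewrite Cayley_Hamilton mul0mx => XA0.
have := congr1 (fun p => X *m horner_mx B p) uv.
rewrite !linearZ /= rmorphD !rmorphM /= Cayley_Hamilton mulr0 addr0.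
rewrite rmorph1 (comm_horner_mx2 B u) -mulmxE mulmxA -XA0 mul0mx.
rewrite scaler0 mulmx1 => /esym/eqP; rewrite scaler_eq0 (negbTE b0) /=.
by move/eqP.
Qed.

Lemma linear_inj_surj (F : fieldType) m n
    (L : {linear 'M[F]_(m, n) -> 'M[F]_(m, n)}) :
  (forall X, L X = 0 -> X = 0) -> forall C, exists X, L X = C.
Proof.
move=> Linj C.
have : row_free (lin_mx L).
  apply: inj_row_free => v; rewrite mul_rV_lin => /(congr1 vec_mx).
  rewrite mxvecK linear0 => /Linj /(congr1 mxvec).
  by rewrite vec_mxK linear0.
rewrite row_free_unit => Lu.
exists (vec_mx (mxvec C *m invmx (lin_mx L))).
by rewrite -mx_rV_lin mulmxKV // mxvecK.
Qed.

Lemma char_poly_trmx (F : comNzRingType) n (A : 'M[F]_n) :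
  char_poly A^T = char_poly A.
Proof.
rewrite /char_poly -det_tr /char_poly_mx linearB /= tr_scalar_mx.
by rewrite map_trmx trmxK.
Qed.

(** The quadratic form of this matrix is the derivative of the one of A along
    the solutions of x' = B x. *)
Definition lyap (R : realType) d (B A : 'M[R]_d) : 'M[R]_d :=
  B^T *m A + A *m B.

Section Hurwitz.
Variables (R : realType) (d : nat).
Implicit Types B C H : 'M[R]_d.

(** A common root z would be an eigenvalue of B together with - z, and both
    cannot have a negative real part. *)
Lemma Hurwitz_coprimep B :
  Hurwitz B -> coprimep (char_poly B^T) (char_poly (- B)).
Proof.
move=> hB; rewrite char_poly_trmx.
rewrite -(coprimep_map (real_complex R)) !map_char_poly.
apply: Pdiv.ClosedField.root_coprimep => z; rewrite -eigenvalue_root_char => Bz.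
apply/negP; rewrite -/(root _ _) -eigenvalue_root_char map_mxN.
move=> /eigenvalueP [v]; rewrite mulmxN => vB v0.
have /hB : eigenvalue (map_mx (real_complex R) B) (- z).
  by apply/eigenvalueP; exists v => //; rewrite scaleNr -vB opprK.
have := hB _ Bz.
case: z {Bz vB} => a b /=; rewrite oppr_lt0 => a0 /(lt_trans a0).
by rewrite ltxx.
Qed.

Lemma Hurwitz_lyapunov_eq B C : Hurwitz B -> exists H, lyap B H = C.
Proof.
move=> hB.
have lyap_linear : linear (lyap B).
  move=> a X Y; rewrite /lyap mulmxDr mulmxDl -scalemxAr -scalemxAl scalerDr.
  by rewrite addrACA.
pose Lm := GRing.isLinear.Build R 'M[R]_d 'M[R]_d *:%R (lyap B) lyap_linear.
pose L : {linear 'M[R]_d -> 'M[R]_d} := HB.pack (lyap B) Lm.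
apply: (linear_inj_surj (L := L)) => X /= /eqP; rewrite addr_eq0 => /eqP LX.
by apply: sylvester_inj (Hurwitz_coprimep hB) _; rewrite LX mulmxN.
Qed.
End Hurwitz.

(** * Entries of the matrix exponential *)

Lemma cvg_mx_entries (R : realType) (T : Type) m n (F : set_system T)
    (f : T -> 'M[R]_(m, n)) (M : 'M[R]_(m, n)) :
  Filter F -> (forall i j, f x i j @[x --> F] --> M i j) -> f @ F --> M.
Proof.
move=> FF fM A [P MP sPA].
suff: \forall x \near F, forall i j, P i j (f x i j).
  by apply: filterS => x /sPA.
by apply: filter_forall => i; apply: filter_forall => j; exact: fM.
Qed.

Section Expmx.
Variables (R : realType) (d : nat) (B : 'M[R]_d).

Definition entry_sum : R := \sum_i \sum_j `|B i j|.

Lemma entry_sum_ge0 : 0 <= entry_sum.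
Proof. by do 2!(apply: sumr_ge0 => ? _). Qed.

Lemma expr_mx_entry_le n i j : `|(B ^+ n) i j| <= entry_sum ^+ n.
Proof.
have N0 := entry_sum_ge0.
elim: n i j => [|n IH] i j.
  by rewrite !expr0 !mxE; case: (i == j); rewrite ?normr1 ?normr0.
rewrite exprS mxE (le_trans (ler_norm_sum _ _ _))//.
have -> : entry_sum ^+ n.+1 = entry_sum * entry_sum ^+ n by rewrite exprS.
apply: (@le_trans _ _ (\sum_k `|B i k| * entry_sum ^+ n)).
  by apply: ler_sum => k _; rewrite normrM ler_wpM2l.
rewrite -mulr_suml ler_wpM2r ?exprn_ge0//.
rewrite [leRHS](bigD1 i) //= lerDl.
by do 2!(apply: sumr_ge0 => ? _); exact: normr_ge0.
Qed.

(** The power series in t with these coefficients is the (i, j) entry of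
    B^k exp (t B), which is the k-th derivative of the one of exp (t B).  The
    parameter k makes the family stable under differentiation. *)
Definition expmx_coef i j k : R^nat := fun n => n`!%:R^-1 * (B ^+ (n + k)) i j.

Lemma expmx_coef_cvg i j k x : cvgn (pseries (expmx_coef i j k) x).
Proof.
have N0 := entry_sum_ge0.
apply: normed_cvg.
apply: (@series_le_cvg _ _
  (fun n => entry_sum ^+ k * exp_coeff (entry_sum * `|x|) n)).
- by move=> n; exact: normr_ge0.
- by move=> n; rewrite /= mulr_ge0 ?exprn_ge0// exp_coeff_ge0// mulr_ge0.
- move=> n; have -> : entry_sum ^+ k * exp_coeff (entry_sum * `|x|) n =
      n`!%:R^-1 * entry_sum ^+ (n + k) * `|x| ^+ n.
    by rewrite /exp_coeff /= exprMn exprD; ring.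
  rewrite /= /expmx_coef !normrM normrX ger0_norm ?invr_ge0 ?ler0n//.
  have h := expr_mx_entry_le (n + k) i j.
  by rewrite ler_wpM2r ?exprn_ge0// ler_wpM2l// invr_ge0 ler0n.
- exact: is_cvg_seriesZ (is_cvg_series_exp_coeff _).
Qed.

Lemma expmx_coef_diffs i j k :
  pseries_diffs (expmx_coef i j k) = expmx_coef i j k.+1.
Proof.
apply/funext => n; rewrite /pseries_diffs /expmx_coef factS natrM invfM addnS.
by rewrite !mulrA mulfV ?mul1r ?pnatr_eq0.
Qed.

Lemma exprZ_mx (t : R) k : (t *: B) ^+ k = t ^+ k *: B ^+ k.
Proof.
elim: k => [|k IH]; first by rewrite !expr0 scale1r.
rewrite 2!exprS IH -!mulmxE -scalemxAl -scalemxAr scalerA -exprS.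
by congr (_ *: _); rewrite mulmxE -exprS.
Qed.

Lemma expmx_entry t i j :
  expmx (t *: B) i j = limn (pseries (expmx_coef i j 0) t).
Proof.
pose M := \matrix_(i, j) limn (pseries (expmx_coef i j 0) t).
suff -> : expmx (t *: B) = M by rewrite mxE.
apply: cvg_lim; first exact: norm_hausdorff.
apply: cvg_mx_entries => a b; rewrite mxE.
rewrite (_ : (fun _ => _) = pseries (expmx_coef a b 0) t).
  exact: expmx_coef_cvg.
apply/funext => n; rewrite /pseries /series /= summxE; apply: eq_bigr => k _.
by rewrite /expmx_coef addn0 exprZ_mx !mxE; ring.
Qed.

Lemma expmx_coef_lim_S i j k t :
  limn (pseries (expmx_coef i j k.+1) t) =
  \sum_l B i l * limn (pseries (expmx_coef l j k) t).
Proof.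
apply: cvg_lim => //.
rewrite (_ : pseries _ _ =
  fun n => \sum_l B i l * pseries (expmx_coef l j k) t n).
  apply: cvg_big => [|l _]; first exact: add_continuous.
  by apply: cvgMl_tmp; exact: expmx_coef_cvg.
apply/funext => n; rewrite /pseries /series /=.
under [RHS]eq_bigr do rewrite mulr_sumr.
rewrite exchange_big /=; apply: eq_bigr => a _.
rewrite /expmx_coef addnS exprS mxE mulr_sumr mulr_suml.
by apply: eq_bigr => l _; ring.
Qed.

Lemma is_derive_expmx_entry t i j :
  is_derive t (1 : R) (fun s => expmx (s *: B) i j) ((B *m expmx (t *: B)) i j).
Proof.
have -> : (fun s => expmx (s *: B) i j) =
    fun s => limn (pseries (expmx_coef i j 0) s).
  by apply/funext => s; exact: expmx_entry.
have -> : (B *m expmx (t *: B)) i j =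
    limn (pseries (pseries_diffs (expmx_coef i j 0)) t).
  rewrite expmx_coef_diffs expmx_coef_lim_S mxE.
  by apply: eq_bigr => l _; rewrite expmx_entry.
apply: (@pseries_snd_diffs _ _ (`|t| + 1));
  rewrite ?expmx_coef_diffs; try exact: expmx_coef_cvg.
by rewrite (ger0_norm (_ : 0 <= `|t| + 1)) ?ltrDl ?addr_ge0.
Qed.

Lemma expmx0 : expmx (0 *: B) = 1%:M.
Proof.
apply/matrixP => i j; rewrite expmx_entry; apply: cvg_lim => //.
apply: cvg_near_cst; exists 1%N => // n /= n0.
rewrite /pseries /series /= -(prednK n0) big_nat_recl// big1 ?addr0.
  by rewrite /expmx_coef addn0 fact0 invr1 !expr0 mul1r mulr1.
by move=> k _; rewrite expr0n mulr0.
Qed.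
End Expmx.

(** * Comparison of functions homogeneous of degree 2 *)

Section Domination.
Variables (R : realType) (d : nat).
Implicit Types f h : 'cV[R]_d -> R.

(** Continuity is asked away from 0 only, so that ratios such as
    f * g / h, with h vanishing at 0 only, qualify. *)
Definition quadratic_like f :=
  (forall a x, f (a *: x) = a ^+ 2 * f x) /\
  (forall x, x != 0 -> {for x, continuous f}).

Lemma trmx_continuous m n : continuous (@trmx R m n).
Proof.
move=> x; apply: (@cvg_mx_entries _ _ _ _ (nbhs x)) => i j; rewrite mxE.
under eq_fun do rewrite mxE.
exact: coord_continuous.
Qed.

Lemma unit_sphere_compact n : compact [set x : 'rV[R]_n | `|x| = 1].
Proof.
apply: bounded_closed_compact.
  by exists 1; split => // e e1 x /= ->; exact: ltW.
rewrite [X in closed X](_ : _ = (fun x : 'rV[R]_n => `|x|) @^-1` [set 1])//.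
apply: preimage_closed; last exact: closed_eq.
by move=> x _; exact: norm_continuous.
Qed.

(** At a point of the unit sphere where f vanishes, h is negative nearby and any
    K >= 0 will do; at the others, f is bounded below and h above nearby, and a
    large K will do.  By compactness one K works on the whole sphere, and by
    homogeneity everywhere. *)
Lemma domination f h : quadratic_like f -> quadratic_like h ->
  (forall x, x != 0 -> 0 <= f x) ->
  (forall x, x != 0 -> f x = 0 -> h x < 0) ->
  \forall K \near +oo, forall x, x != 0 -> h x < K * f x.
Proof.
move=> [fZ fC] [hZ hC] f0 fh.
pose g (K : R) (y : 'rV[R]_d) := h y^T < K * f y^T.
have y0 (y : 'rV[R]_d) : `|y| = 1 -> y^T != 0.
  move=> y1; apply/eqP => /(congr1 trmx); rewrite trmxK trmx0 => yE.
  by move: y1; rewrite yE normr0 => /eqP; rewrite eq_sym oner_eq0.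
have cov : \forall K \near +oo, [set y : 'rV[R]_d | `|y| = 1] `<=` g K.
  have /compact_near_coveringP/near_covering_withinP := @unit_sphere_compact d.
  move=> /(_ _ _ g); apply => y /= y1.
  have fCy : f z^T @[z --> y] --> f y^T.
    by apply: (cvg_comp _ _ (@trmx_continuous _ _ y)); exact/fC/y0.
  have hCy : h z^T @[z --> y] --> h y^T.
    by apply: (cvg_comp _ _ (@trmx_continuous _ _ y)); exact/hC/y0.
  have [fy0|fy0] := eqVneq (f y^T) 0.
    have hy := fh _ (y0 _ y1) fy0.
    exists ([set z | h z^T < 0], [set K | 0 <= K]) => /=.
      by split; [exact: cvgr_lt hCy _ hy | exact: nbhs_pinfty_ge].
    move=> [z K] [/= hz K0] z1; apply: (lt_le_trans hz).
    by apply: mulr_ge0 => //; exact/f0/y0.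
  have fyp : 0 < f y^T by rewrite lt_neqAle eq_sym fy0 f0 ?y0.
  exists ([set z | h z^T < h y^T + 1 /\ f y^T / 2 < f z^T],
          [set K | 0 <= K /\ (h y^T + 1) / (f y^T / 2) < K]) => /=.
    split; apply: filterI.
    - by apply: cvgr_lt hCy _ _; rewrite ltrDl.
    - by apply: cvgr_gt fCy _ _; rewrite ltr_pdivrMr// ltr_pMr// ltr1n.
    - exact: nbhs_pinfty_ge.
    - by apply: nbhs_pinfty_gt; exact: num_real.
  move=> [z K] [/= [hz fz] [K0 hK]] z1; apply: (lt_trans hz).
  apply: (@lt_le_trans _ _ (K * (f y^T / 2))).
    by rewrite -ltr_pdivrMr ?divr_gt0.
  by rewrite ler_wpM2l// ltW.
move: cov; apply: filterS => K gK x x0.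
have yN0 : `|x^T| != 0.
  rewrite normr_eq0; apply: contra_neq x0 => /(congr1 trmx).
  by rewrite trmxK trmx0.
have xE : x = `|x^T| *: (`|x^T|^-1 *: x^T)^T.
  by rewrite linearZ /= trmxK scalerA mulfV// scale1r.
rewrite xE fZ hZ mulrCA ltr_pM2l ?exprn_even_gt0 //.
by apply: gK; rewrite /= normrZ normfV normr_id mulVf.
Qed.
End Domination.

(** * Quadratic forms and their derivatives along a linear flow *)

Section QuadForm.
Variables (R : realType) (d : nat).
Implicit Types (A B P Q : 'M[R]_d) (x y : 'cV[R]_d).

Lemma quad_formE Q x :
  quad_form Q x = \sum_i \sum_j x i 0 * Q i j * x j 0.
Proof.
rewrite /quad_form mxE exchange_big /=; apply: eq_bigr => j _.
by rewrite mxE mulr_suml; apply: eq_bigr => i _; rewrite mxE.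
Qed.

Lemma quad_formD A Q x : quad_form (A + Q) x = quad_form A x + quad_form Q x.
Proof. by rewrite /quad_form mulmxDr mulmxDl mxE. Qed.

Lemma quad_formN Q x : quad_form (- Q) x = - quad_form Q x.
Proof. by rewrite /quad_form mulmxN mulNmx mxE. Qed.

Lemma quad_form0 Q : quad_form Q 0 = 0.
Proof. by rewrite /quad_form mulmx0 mxE. Qed.

Lemma quad_formZ Q a x : quad_form Q (a *: x) = a ^+ 2 * quad_form Q x.
Proof.
rewrite /quad_form [(a *: x)^T]linearZ /= -!scalemxAl -scalemxAr.
by rewrite scalerA mxE expr2.
Qed.

Lemma quad_form1 x : quad_form 1%:M x = \sum_i x i 0 ^+ 2.
Proof.
rewrite /quad_form mulmx1 mxE; apply: eq_bigr => i _.
by rewrite mxE expr2.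
Qed.

Lemma quad_form1_gt0 x : x != 0 -> 0 < quad_form 1%:M x.
Proof.
move=> x0; rewrite quad_form1 lt_neqAle sumr_ge0 ?andbT; last first.
  by move=> i _; exact: sqr_ge0.
rewrite eq_sym; apply: contra_neq x0 => /eqP.
rewrite psumr_eq0 => [/allP x0|i _]; last exact: sqr_ge0.
apply/colP => i; rewrite mxE; apply/eqP.
by have := x0 i (mem_index_enum i); rewrite implyTb sqrf_eq0.
Qed.

Lemma lyapD B A Q : lyap B (A + Q) = lyap B A + lyap B Q.
Proof. by rewrite /lyap mulmxDr mulmxDl addrACA. Qed.

Lemma lyapN B Q : lyap B (- Q) = - lyap B Q.
Proof. by rewrite /lyap mulmxN mulNmx opprD. Qed.

Lemma quad_formDl Q x y : quad_form Q (x + y) =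
  quad_form Q x + (x^T *m Q *m y + y^T *m Q *m x) 0 0 + quad_form Q y.
Proof.
have addE (M N : 'M[R]_1) : (M + N) 0 0 = M 0 0 + N 0 0 by rewrite mxE.
by rewrite /quad_form [(x + y)^T]linearD /= !mulmxDl !mulmxDr !addE; ring.
Qed.

(** A zero of a nonnegative form is a minimum, so that the differential of the
    form vanishes there: s |-> q (x + s y) = s c + s^2 q y is nonnegative for
    all s, which forces the linear coefficient c to be 0. *)
Lemma psd_null_cross Q x y : (forall z, 0 <= quad_form Q z) ->
  quad_form Q x = 0 -> (x^T *m Q *m y + y^T *m Q *m x) 0 0 = 0.
Proof.
move=> Q0 Qx; set c := (x^T *m Q *m y + _) 0 0.
have H s : 0 <= s * c + s ^+ 2 * quad_form Q y.
  have := Q0 (x + s *: y); rewrite quad_formDl Qx add0r quad_formZ.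
  by rewrite [(s *: y)^T]linearZ /= -!scalemxAl -!scalemxAr -scalerDr mxE.
have {Q0} := Q0 y; set b := quad_form Q y in H * => b0.
have b1 : 0 < b + 1 by rewrite ltr_wpDl.
(* For this s the value is - (c / (b + 1))^2; the denominator is b + 1 rather
   than b because b = q y may be 0. *)
have := H (- c / (b + 1)).
rewrite [X in 0 <= X](_ : _ = - (c / (b + 1)) ^+ 2); last first.
  by field; rewrite gt_eqF.
rewrite oppr_ge0 => cb; have /eqP : (c / (b + 1)) ^+ 2 = 0.
  by apply/eqP; rewrite eq_le cb sqr_ge0.
by rewrite sqrf_eq0 mulf_eq0 invr_eq0 (gt_eqF b1) orbF => /eqP.
Qed.

Lemma quad_form_lyap B Q x : quad_form (lyap B Q) x =
  (x^T *m Q *m (B *m x) + (B *m x)^T *m Q *m x) 0 0.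
Proof.
rewrite /quad_form /lyap trmx_mul mulmxDr mulmxDl addrC.
by rewrite !mulmxA.
Qed.

Lemma psd_null_lyap B Q x : (forall z, 0 <= quad_form Q z) ->
  quad_form Q x = 0 -> quad_form (lyap B Q) x = 0.
Proof. by move=> Q0 Qx; rewrite quad_form_lyap psd_null_cross. Qed.

(** With y = Q x, the two cross terms of the differential are both |Q x|^2. *)
Lemma psd_null_ker Q x : Q^T = Q -> (forall z, 0 <= quad_form Q z) ->
  quad_form Q x = 0 -> Q *m x = 0.
Proof.
move=> QT Q0 Qx.
have := psd_null_cross (Q *m x) Q0 Qx.
have -> : x^T *m Q *m (Q *m x) = (Q *m x)^T *m 1%:M *m (Q *m x).
  by rewrite trmx_mul QT mulmx1.
rewrite -[in X in _ + X]mulmxA -[in X in _ + X](mulmx1 (Q *m x)^T).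
rewrite mxE -/(quad_form _ _) => Qx0.
apply/eqP; apply: contraTT isT => /quad_form1_gt0.
have -> : quad_form 1%:M (Q *m x) = 0 by lra.
by rewrite ltxx.
Qed.

Lemma quad_form_continuous Q : continuous (quad_form Q).
Proof.
rewrite (_ : quad_form Q = fun y => \sum_i \sum_j y i 0 * Q i j * y j 0);
  last first.
  by apply/funext => y; exact: quad_formE.
apply: continuous_big => [|i _]; first exact: add_continuous.
apply: continuous_big => [|j _]; first exact: add_continuous.
move=> x; apply: (@continuousM _ _ (fun y : 'cV[R]_d => y i 0 * Q i j)).
  apply: (@continuousM _ _ (fun y : 'cV[R]_d => y i 0)).
    exact: coord_continuous.
  exact: cst_continuous.
exact: coord_continuous.
Qed.

Lemma quadratic_like_form Q : quadratic_like (quad_form Q).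
Proof.
split; first by move=> a x; exact: quad_formZ.
by move=> x _; exact: quad_form_continuous.
Qed.

Lemma is_derive_quad_form (X : R -> 'cV[R]_d) (dX : 'cV[R]_d) t Q :
  (forall i, is_derive t (1 : R) (fun s => X s i 0) (dX i 0)) ->
  is_derive t (1 : R) (fun s => quad_form Q (X s))
    (((X t)^T *m Q *m dX + dX^T *m Q *m X t) 0 0).
Proof.
move=> HX.
rewrite (_ : (fun s => _) =
  \sum_i \sum_j ((fun s => X s i 0) * cst (Q i j) * (fun s => X s j 0)));
  last first.
  apply/funext => s; rewrite quad_formE fct_sumE; apply: eq_bigr => i _.
  by rewrite fct_sumE; apply: eq_bigr => j _.
apply: (@is_derive_eq _ _ _ _ _ _ _ (\sum_i \sum_j
  ((X t i 0 * Q i j) *: dX j 0 + X t j 0 *: (X t i 0 *: 0 + Q i j *: dX i 0)))).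
  apply: is_derive_sum => i; apply: is_derive_sum => j.
  exact: (is_deriveM (is_deriveM (HX i) (is_derive_cst (Q i j) t 1)) (HX j)).
rewrite mxE !mxE -big_split /= exchange_big /=.
apply: eq_bigr => j _; rewrite !mxE !mulr_suml -big_split /=.
apply: eq_bigr => i _; rewrite !mxE scaler0 add0r /GRing.scale /=; ring.
Qed.

Lemma is_derive_flow_quad_form B Q x t :
  is_derive t (1 : R) (fun s => quad_form Q (expmx (s *: B) *m x))
    (quad_form (lyap B Q) (expmx (t *: B) *m x)).
Proof.
rewrite quad_form_lyap.
apply: is_derive_quad_form => i; rewrite mulmxA.
rewrite (_ : (fun s => _) =
  \sum_j ((fun s => expmx (s *: B) i j) * cst (x j 0))); last first.
  by apply/funext => s; rewrite mxE fct_sumE.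
apply: (@is_derive_eq _ _ _ _ _ _ _ (\sum_j
  (expmx (t *: B) i j *: 0 + x j 0 *: (B *m expmx (t *: B)) i j))).
  apply: is_derive_sum => j.
  exact: (is_deriveM (is_derive_expmx_entry B t i j)
    (is_derive_cst (x j 0) t 1)).
rewrite [RHS]mxE; apply: eq_bigr => j _.
by rewrite scaler0 add0r mulrC.
Qed.

End QuadForm.

Section Monotone.
Variable R : realType.
Implicit Types g dg : R -> R.

Lemma is_derive_le0_nonincreasing g dg (s : R) :
  (forall t : R, 0 <= t -> is_derive t (1 : R) g (dg t)) ->
  (forall t : R, 0 <= t -> dg t <= 0) -> 0 <= s -> g s <= g 0.
Proof.
move=> gd gle s0.
apply: (@ler0_derive1_le_cc _ g 0 s) => //.
- by move=> t; rewrite in_itv /= => /andP[t0 _]; case: (gd _ (ltW t0)).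
- move=> t; rewrite in_itv /= => /andP[/ltW t0 _]; rewrite derive1E.
  by case: (gd _ t0) => _ ->; exact: gle.
- apply: derivable_within_continuous => t; rewrite in_itv /= => /andP[t0 _].
  by case: (gd _ t0).
- by rewrite in_itv /= lexx s0.
- by rewrite in_itv /= lexx s0.
Qed.

Lemma is_derive_expRM (k : R) g (dg t : R) : is_derive t (1 : R) g dg ->
  is_derive t (1 : R) (fun s => expR (k * s) * g s)
    (expR (k * t) * (k * g t + dg)).
Proof.
move=> gd.
have kd : is_derive t (1 : R) (fun s : R => k * s) k.
  apply: is_derive_eq (is_deriveM (is_derive_cst k t 1) (is_derive_id t 1)) _.
  by rewrite scaler0 addr0 /cst /GRing.scale /= mulr1.
have ed := is_derive1_comp (is_derive_expR (k * t)) kd.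
apply: is_derive_eq (is_deriveM ed gd) _.
rewrite /GRing.scale /=; ring.
Qed.
End Monotone.

(** * Derivatives along a linear flow and exponential decay *)

Section Lyapunov.
Variables (R : realType) (d : nat).
Implicit Types (A B P Q G H : 'M[R]_d) (x : 'cV[R]_d) (F DF : 'cV[R]_d -> R).

Lemma quadratic_like0 F : quadratic_like F -> F 0 = 0.
Proof. by move=> [FZ _]; rewrite -(scale0r (0 : 'cV[R]_d)) FZ expr0n mul0r. Qed.

Lemma quadratic_likeN F : quadratic_like F -> quadratic_like (fun x => - F x).
Proof.
move=> [FZ FC]; split=> [a x|x x0]; first by rewrite FZ mulrN.
by apply: continuousN; exact: FC.
Qed.

Lemma quadratic_likeD F1 F2 : quadratic_like F1 -> quadratic_like F2 ->
  quadratic_like (fun x => F1 x + F2 x).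
Proof.
move=> [F1Z F1C] [F2Z F2C]; split=> [a x|x x0]; first by rewrite F1Z F2Z mulrDr.
by apply: continuousD; [exact: F1C|exact: F2C].
Qed.

Lemma quadratic_likeZ k F :
  quadratic_like F -> quadratic_like (fun x => k * F x).
Proof.
move=> [FZ FC]; split=> [a x|x x0]; first by rewrite FZ mulrCA.
by apply: (@continuousM _ _ (fun=> k)); [exact: cst_continuous|exact: FC].
Qed.

Definition mul_div F1 F2 F3 x : R := F1 x * F2 x / F3 x.

Lemma quadratic_like_mul_div F1 F2 F3 :
  quadratic_like F1 -> quadratic_like F2 -> quadratic_like F3 ->
  (forall x, x != 0 -> F3 x != 0) -> quadratic_like (mul_div F1 F2 F3).
Proof.
move=> [F1Z F1C] [F2Z F2C] [F3Z F3C] F30; split=> [a x|x x0]; last first.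
  apply: (@continuousM _ _ (fun x => F1 x * F2 x) (fun x => (F3 x)^-1)).
    by apply: continuousM; [exact: F1C|exact: F2C].
  by apply: continuousV; [exact: F30|exact: F3C].
rewrite /mul_div F1Z F2Z F3Z.
have [->|a0] := eqVneq a 0; first by rewrite expr0n !mul0r.
rewrite invfM.
rewrite [LHS](_ : _ = (a ^+ 2 / a ^+ 2) * (a ^+ 2 * (F1 x * F2 x / F3 x)));
  last by ring.
by rewrite divff ?mul1r// expf_neq0.
Qed.

(** The orbit of 0 is left out because the quotient rule asks for a nonzero
    denominator; no other orbit meets 0 (flow_neq0). *)
Definition orbital_derivative B F DF := forall x (t : R), 0 <= t -> x != 0 ->
  is_derive t (1 : R) (fun s => F (expmx (s *: B) *m x))
    (DF (expmx (t *: B) *m x)).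

Lemma expmx_flow0 B x : expmx (0 *: B) *m x = x.
Proof. by rewrite expmx0 mul1mx. Qed.

(** By domination the derivative of |x|^2 is at least - K |x|^2 for some K,
    hence exp (K t) |x(t)|^2 is nondecreasing. *)
Lemma flow_neq0 B x (t : R) : x != 0 -> 0 <= t -> expmx (t *: B) *m x != 0.
Proof.
move=> x0 t0.
have : \forall K \near +oo, forall x, x != 0 ->
    - quad_form (lyap B 1%:M) x < K * quad_form 1%:M x.
  apply: domination; first exact: quadratic_like_form.
  - exact/quadratic_likeN/quadratic_like_form.
  - by move=> y /quad_form1_gt0/ltW.
  - by move=> y /quad_form1_gt0; rewrite lt_neqAle eq_sym => /andP[/eqP].
move=> /filter_ex [K HK].
pose y s := expmx (s *: B) *m x.
have yt : expR (K * t) * quad_form (- 1%:M) (y t) <=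
          expR (K * 0) * quad_form (- 1%:M) (y 0).
  apply: (is_derive_le0_nonincreasing
    (g := fun s => expR (K * s) * quad_form (- 1%:M) (y s))
    (dg := fun s => expR (K * s) * (K * quad_form (- 1%:M) (y s) +
      quad_form (lyap B (- 1%:M)) (y s)))) => // s s0.
    by apply: is_derive_expRM; exact: is_derive_flow_quad_form.
  rewrite pmulr_rle0 ?expR_gt0// lyapN !quad_formN mulrN -opprD oppr_le0.
  have [->|/HK] := eqVneq (y s) 0; first by rewrite !quad_form0 mulr0 addr0.
  by rewrite -subr_gt0 opprK => /ltW.
apply/eqP => yt0; move: yt; rewrite {1}/y yt0 quad_form0 !mulr0 expR0 mul1r.
by rewrite /y expmx_flow0 leNgt quad_formN oppr_lt0 quad_form1_gt0.
Qed.

(** The derivative of exp (k t) F is exp (k t) (k F + F'). *)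
Lemma orbital_decay B F DF k : orbital_derivative B F DF -> F 0 = 0 ->
  (forall x, x != 0 -> k * F x + DF x <= 0) ->
  forall x (t : R), 0 <= t -> F (expmx (t *: B) *m x) <= expR (- (k * t)) * F x.
Proof.
move=> FD F0 Fle x t t0.
have [->|x0] := eqVneq x 0; first by rewrite mulmx0 F0 mulr0.
pose y s := expmx (s *: B) *m x.
have yt : expR (k * t) * F (y t) <= expR (k * 0) * F (y 0).
  apply: (is_derive_le0_nonincreasing (g := fun s => expR (k * s) * F (y s))
    (dg := fun s => expR (k * s) * (k * F (y s) + DF (y s)))) => // s s0.
    by apply: is_derive_expRM; exact: FD.
  by rewrite pmulr_rle0 ?expR_gt0// Fle// flow_neq0.
move: yt; rewrite mulr0 expR0 mul1r {2}/y expmx_flow0 => yt.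
by rewrite expRN mulrC ler_pdivlMr ?expR_gt0// mulrC.
Qed.

Lemma orbital_derivative_quad_form B Q :
  orbital_derivative B (quad_form Q) (quad_form (lyap B Q)).
Proof. by move=> x t _ _; exact: is_derive_flow_quad_form. Qed.

Lemma orbital_derivativeD B F1 DF1 F2 DF2 :
  orbital_derivative B F1 DF1 -> orbital_derivative B F2 DF2 ->
  orbital_derivative B (fun x => F1 x + F2 x) (fun x => DF1 x + DF2 x).
Proof.
by move=> D1 D2 x t t0 x0; exact: is_deriveD (D1 _ _ t0 x0) (D2 _ _ t0 x0).
Qed.

Lemma orbital_derivativeZ B F DF k : orbital_derivative B F DF ->
  orbital_derivative B (fun x => k * F x) (fun x => k * DF x).
Proof.
move=> D x t t0 x0.
apply: is_derive_eq (is_deriveM (is_derive_cst k t 1) (D _ _ t0 x0)) _.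
by rewrite scaler0 addr0.
Qed.

Lemma orbital_derivative_mul_div B F1 DF1 F2 DF2 F3 DF3 :
  (forall x, x != 0 -> F3 x != 0) ->
  orbital_derivative B F1 DF1 -> orbital_derivative B F2 DF2 ->
  orbital_derivative B F3 DF3 ->
  orbital_derivative B (mul_div F1 F2 F3)
    (fun x => mul_div DF1 F2 F3 x + mul_div F1 DF2 F3 x -
              mul_div (mul_div F1 F2 F3) DF3 F3 x).
Proof.
move=> F30 D1 D2 D3 x t t0 x0.
have F3t : F3 (expmx (t *: B) *m x) != 0 by apply: F30; exact: flow_neq0.
apply: is_derive_eq (is_deriveM (is_deriveM (D1 _ _ t0 x0) (D2 _ _ t0 x0))
  (is_deriveV F3t (D3 _ _ t0 x0))) _.
rewrite /mul_div mulrfctE.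
move: (expmx (t *: B) *m x) F3t => y F3y.
by rewrite /GRing.scale /=; field.
Qed.
End Lyapunov.

(** * The strict common Lyapunov function *)

Section Blend.
Variables (R : realType) (d : nat).
Implicit Types (A B P Q G H : 'M[R]_d) (x : 'cV[R]_d).

(** This is theta V_1 + (1 - theta) V_2 with theta = q_2 / (q_1 + q_2), where
    q_i and V_i are the quadratic forms of Q_i and H_i, written as
    V_2 + theta (V_1 - V_2). *)
Definition blend Q1 Q2 H1 H2 x : R :=
  quad_form H2 x +
  mul_div (quad_form Q2) (quad_form (H1 - H2)) (quad_form (Q1 + Q2)) x.

Definition blend_derivative B Q1 Q2 H1 H2 x : R :=
  quad_form (lyap B H2) x +
  (mul_div (quad_form (lyap B Q2)) (quad_form (H1 - H2))
     (quad_form (Q1 + Q2)) x +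
   mul_div (quad_form Q2) (quad_form (lyap B (H1 - H2)))
     (quad_form (Q1 + Q2)) x -
   mul_div (mul_div (quad_form Q2) (quad_form (H1 - H2)) (quad_form (Q1 + Q2)))
     (quad_form (lyap B (Q1 + Q2))) (quad_form (Q1 + Q2)) x).

Variables (Q1 Q2 H1 H2 : 'M[R]_d).
Hypothesis Q1_ge0 : forall x, 0 <= quad_form Q1 x.
Hypothesis Q2_ge0 : forall x, 0 <= quad_form Q2 x.
Hypothesis Q12_null : forall x,
  quad_form Q1 x = 0 -> quad_form Q2 x = 0 -> x = 0.

Lemma sum_form_neq0 x : x != 0 -> quad_form (Q1 + Q2) x != 0.
Proof.
apply: contra_neq; rewrite quad_formD => /eqP.
by rewrite paddr_eq0// => /andP[/eqP ? /eqP ?]; exact: Q12_null.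
Qed.

Lemma quadratic_like_blend : quadratic_like (blend Q1 Q2 H1 H2).
Proof.
apply: quadratic_likeD; first exact: quadratic_like_form.
by apply: quadratic_like_mul_div => [| | |x];
  [exact: quadratic_like_form..|exact: sum_form_neq0].
Qed.

Lemma quadratic_like_blend_derivative B :
  quadratic_like (blend_derivative B Q1 Q2 H1 H2).
Proof.
have QL Q : quadratic_like (quad_form Q) by exact: quadratic_like_form.
apply: quadratic_likeD => //; apply: quadratic_likeD.
  by apply: quadratic_likeD; apply: quadratic_like_mul_div => // x;
    exact: sum_form_neq0.
apply: quadratic_likeN; apply: quadratic_like_mul_div => // [|x].
  2: exact: sum_form_neq0.
by apply: quadratic_like_mul_div => // x; exact: sum_form_neq0.
Qed.

Lemma orbital_derivative_blend B :
  orbital_derivative B (blend Q1 Q2 H1 H2) (blend_derivative B Q1 Q2 H1 H2).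
Proof.
have OD Q := @orbital_derivative_quad_form _ _ B Q.
apply: orbital_derivativeD => //; apply: orbital_derivative_mul_div => // x.
exact: sum_form_neq0.
Qed.

(** Where q_1 vanishes so does its derivative (psd_null_lyap): theta is 1 and is
    stationary. *)
Lemma blend_derivative_on_null1 B x : x != 0 -> quad_form Q1 x = 0 ->
  blend_derivative B Q1 Q2 H1 H2 x = quad_form (lyap B H1) x.
Proof.
move=> x0 Qx; have := sum_form_neq0 x0.
rewrite /blend_derivative /mul_div !lyapD lyapN (quad_formD Q1) (quad_formD H1).
rewrite (quad_formD (lyap B Q1)) (quad_formD (lyap B H1)) !quad_formN Qx.
rewrite (psd_null_lyap B Q1_ge0 Qx) !add0r => Q2x.
by field.
Qed.

Lemma blend_derivative_on_null2 B x : x != 0 -> quad_form Q2 x = 0 ->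
  blend_derivative B Q1 Q2 H1 H2 x = quad_form (lyap B H2) x.
Proof.
move=> x0 Qx; rewrite /blend_derivative /mul_div Qx (psd_null_lyap B Q2_ge0 Qx).
by rewrite !mul0r !addr0 subr0 addr0.
Qed.
End Blend.

Section StrictLyapunov.
Variables (R : realType) (d : nat) (B1 B2 P : 'M[R]_d).
Hypotheses (hB1 : Hurwitz B1) (hB2 : Hurwitz B2).
Hypothesis P_gt0 : forall x : 'cV[R]_d, x != 0 -> 0 < quad_form P x.
Hypotheses (hL1 : weak_Lyapunov P B1) (hL2 : weak_Lyapunov P B2).
Hypothesis null_trivial : forall x : 'cV[R]_d,
  quad_form (lyap B1 P) x = 0 -> quad_form (lyap B2 P) x = 0 -> x = 0.

(** W = K x^T P x + blend.  Three lower bounds on K are needed: one for the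
    positivity of W, and one for the sign of its derivative in each mode. *)
Lemma strict_common_Lyapunov : exists W DW1 DW2 : 'cV[R]_d -> R,
  [/\ quadratic_like W, forall x, x != 0 -> 0 < W x,
   [/\ quadratic_like DW1, orbital_derivative B1 W DW1 &
      forall x, x != 0 -> DW1 x < 0] &
   [/\ quadratic_like DW2, orbital_derivative B2 W DW2 &
      forall x, x != 0 -> DW2 x < 0]].
Proof.
have [H1 LH1] := Hurwitz_lyapunov_eq (- 1%:M) hB1.
have [H2 LH2] := Hurwitz_lyapunov_eq (- 1%:M) hB2.
pose Q1 := - lyap B1 P; pose Q2 := - lyap B2 P.
have Q1_ge0 x : 0 <= quad_form Q1 x by rewrite quad_formN oppr_ge0; exact: hL1.
have Q2_ge0 x : 0 <= quad_form Q2 x by rewrite quad_formN oppr_ge0; exact: hL2.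
have Q12 x : quad_form Q1 x = 0 -> quad_form Q2 x = 0 -> x = 0.
  rewrite !quad_formN => /eqP + /eqP; rewrite !oppr_eq0 => /eqP ? /eqP ?.
  exact: null_trivial.
pose V := blend Q1 Q2 H1 H2.
pose DV B := blend_derivative B Q1 Q2 H1 H2.
have Vq : quadratic_like V by exact: quadratic_like_blend.
have DVq B : quadratic_like (DV B) by exact: quadratic_like_blend_derivative.
have QL Q : quadratic_like (quad_form Q) by exact: quadratic_like_form.
have pos : \forall K \near +oo, forall x, x != 0 -> - V x < K * quad_form P x.
  apply: domination => //; first exact: quadratic_likeN.
    by move=> x /P_gt0/ltW.
  by move=> x /P_gt0; rewrite lt_neqAle eq_sym => /andP[/eqP].
have dec1 : \forall K \near +oo, forall x, x != 0 ->
    DV B1 x < K * quad_form Q1 x.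
  apply: domination => // x x0 Qx; rewrite /DV blend_derivative_on_null1//.
  by rewrite LH1 quad_formN oppr_lt0 quad_form1_gt0.
have dec2 : \forall K \near +oo, forall x, x != 0 ->
    DV B2 x < K * quad_form Q2 x.
  apply: domination => // x x0 Qx; rewrite /DV blend_derivative_on_null2//.
  by rewrite LH2 quad_formN oppr_lt0 quad_form1_gt0.
have [K [[Kpos K1] K2]] := filter_ex (filterI (filterI pos dec1) dec2).
exists (fun x => K * quad_form P x + V x),
  (fun x => K * quad_form (lyap B1 P) x + DV B1 x),
  (fun x => K * quad_form (lyap B2 P) x + DV B2 x).
have WL B : quadratic_like (fun x => K * quad_form (lyap B P) x + DV B x).
  by apply: quadratic_likeD => //; exact: quadratic_likeZ.
have OD B : orbital_derivative B (fun x => K * quad_form P x + V x)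
    (fun x => K * quad_form (lyap B P) x + DV B x).
  apply: orbital_derivativeD; last exact: orbital_derivative_blend.
  exact/orbital_derivativeZ/orbital_derivative_quad_form.
split.
- by apply: quadratic_likeD => //; exact: quadratic_likeZ.
- by move=> x /Kpos; rewrite -subr_gt0 opprK.
- by split => // x /K1; rewrite quad_formN mulrN -subr_lt0 opprK addrC.
- by split => // x /K2; rewrite quad_formN mulrN -subr_lt0 opprK addrC.
Qed.

(** By domination a negative derivative DW_i satisfies W < M (- DW_i) for M
    large, which is decay at the rate 1 / M. *)
Lemma exponential_Lyapunov : exists (W : 'cV[R]_d -> R) (k C : R),
  [/\ 0 < k, 0 <= C, forall x, quad_form 1%:M x <= C * W x &
   forall (i : 'I_2) x (t : R), 0 <= t ->
     W (expmx (t *: mode_mx B1 B2 i) *m x) <= expR (- (k * t)) * W x].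
Proof.
have [W [DW1 [DW2 [Wq W0 [D1q D1 D1lt] [D2q D2 D2lt]]]]] :=
  strict_common_Lyapunov.
have neg DW : quadratic_like DW -> (forall x, x != 0 -> DW x < 0) ->
    \forall M \near +oo, forall x, x != 0 -> W x < M * (- DW x).
  move=> DWq DWlt; apply: domination => //; first exact: quadratic_likeN.
    by move=> x /DWlt; rewrite oppr_ge0 => /ltW.
  move=> x /DWlt; rewrite -oppr_gt0 lt_neqAle eq_sym => /andP[/eqP + _ /eqP].
  by move=> + /eqP.
have up : \forall C \near +oo, forall x, x != 0 -> quad_form 1%:M x < C * W x.
  apply: domination => //; first exact: quadratic_like_form.
    by move=> x /W0/ltW.
  by move=> x /W0; rewrite lt_neqAle eq_sym => /andP[/eqP].
have [C [C0 HC]] :=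
  filter_ex (filterI (nbhs_pinfty_ge (num_real (0 : R))) up).
have [M [[M0 M1] M2]] := filter_ex (filterI
  (filterI (nbhs_pinfty_gt (num_real (0 : R))) (neg _ D1q D1lt))
  (neg _ D2q D2lt)).
have rate DW : (forall x, x != 0 -> W x < M * (- DW x)) ->
    forall x, x != 0 -> M^-1 * W x + DW x <= 0.
  move=> H x /H; rewrite mulrC -ltr_pdivrMr// => Wx.
  by rewrite mulrC -lerBrDr sub0r ltW.
have W00 := quadratic_like0 Wq.
exists W, M^-1, C; split; [by rewrite invr_gt0|by []| |].
  move=> x; have [->|/HC/ltW//] := eqVneq x 0.
  by rewrite quad_form0 W00 mulr0.
move=> i x t t0; rewrite /mode_mx; case: ifP => _.
  exact: (orbital_decay D1 W00 (rate _ M1)).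
exact: (orbital_decay D2 W00 (rate _ M2)).
Qed.
End StrictLyapunov.

(** * Decay along a switched trajectory *)

Section Switching.
Variables (R : realType) (d : nat) (B1 B2 : 'M[R]_d) (u : input R).
Variables (W : 'cV[R]_d -> R) (k C : R).
Hypothesis k_gt0 : 0 < k.
Hypothesis W_ge : forall x, quad_form 1%:M x <= C * W x.
Hypothesis W_decay : forall (i : 'I_2) x (t : R), 0 <= t ->
  W (expmx (t *: mode_mx B1 B2 i) *m x) <= expR (- (k * t)) * W x.

Lemma switch_indexP (t : R) : 0 <= t ->
  switch_time u (switch_index u t) <= t < switch_time u (switch_index u t).+1.
Proof.
move=> t0; apply: (@xgetPex _ 0%N
  [set n | switch_time u n <= t < switch_time u n.+1]).
have tn : exists n, t < switch_time u n.
  by apply: (@filter_ex _ \oo); move/cvgryPgt: (@switch_time_cvg _ u); exact.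
case: (ex_minnP tn) => -[|n] tn1 nmin.
  by move: tn1; rewrite switch_time0 ltNge t0.
exists n; rewrite /= tn1 andbT leNgt.
by apply/negP => /nmin; rewrite ltnn.
Qed.

Lemma Phi_switch_decay n x :
  W (Phi_switch B1 B2 u n *m x) <= expR (- (k * switch_time u n)) * W x.
Proof.
elim: n => [|n IH] /=.
  by rewrite switch_time0 mulr0 oppr0 expR0 mul1mx mul1r.
rewrite -mulmxA (le_trans (W_decay _ _ _)) ?subr_ge0;
  rewrite ?(ltW (switch_time_lt u n))//.
have -> : - (k * switch_time u n.+1) =
    - (k * dwell u n) + - (k * switch_time u n) by rewrite /dwell; ring.
by rewrite expRD -mulrA ler_wpM2l// expR_ge0.
Qed.

Lemma Phi_decay x (t : R) : 0 <= t ->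
  W (Phi B1 B2 u t *m x) <= expR (- (k * t)) * W x.
Proof.
move=> /switch_indexP /andP[]; rewrite /Phi; move: (switch_index u t) => n nt _.
rewrite -mulmxA (le_trans (W_decay _ _ _)) ?subr_ge0//.
have -> : - (k * t) =
    - (k * (t - switch_time u n)) + - (k * switch_time u n) by ring.
by rewrite expRD -mulrA ler_wpM2l ?expR_ge0// Phi_switch_decay.
Qed.

Lemma decay_asymptotically_stable : 0 <= C -> asymptotically_stable B1 B2 u.
Proof.
move=> C0 x; apply: cvg_mx_entries => i j; rewrite (ord1 j) mxE.
(* The bound C W x exp (- k t) concerns the squared norm: entries decay at half
   that rate. *)
set M := Num.sqrt (C * W x).
have bnd t : 0 <= t -> `|(Phi B1 B2 u t *m x) i 0| <= M * expR (- (k / 2 * t)).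
  move=> t0; rewrite -(@ler_pXn2r _ 2) ?nnegrE ?mulr_ge0 ?sqrtr_ge0 ?expR_ge0//.
  rewrite exprMn sqr_sqrtr; last first.
    rewrite (le_trans _ (W_ge x))// quad_form1 sumr_ge0// => ? _.
    exact: sqr_ge0.
  rewrite real_normK ?num_real// (expr2 (expR _)) -expRD -opprD -mulrDl -splitr.
  rewrite (@le_trans _ _ (quad_form 1%:M (Phi B1 B2 u t *m x)))//.
    rewrite quad_form1 (bigD1 i)//= lerDl sumr_ge0// => a _; exact: sqr_ge0.
  by rewrite (le_trans (W_ge _))// -mulrA ler_wpM2l// mulrC Phi_decay.
have E0 : M * expR (- (k / 2 * t)) @[t --> +oo] --> (0 : R).
  rewrite -(mulr0 M); apply: cvgMl_tmp.
  apply: (@cvg_comp _ _ _ (fun t : R => k / 2 * t) (fun t => expR (- t)) _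
    (pinfty_nbhs R)); last exact: cvgr_expR.
  by apply: gt0_cvgMry; [rewrite divr_gt0|exact: cvg_id].
apply: (@squeeze_cvgr _ _ _ _ (fun t => - (M * expR (- (k / 2 * t))))
  (fun t => M * expR (- (k / 2 * t)))) => //.
  near=> t; rewrite -ler_norml; apply: bnd.
  by near: t; apply: nbhs_pinfty_ge; exact: num_real.
by rewrite -oppr0; exact: cvgN.
Unshelve. all: by end_near.
Qed.
End Switching.

(** * Stability for every input *)

Theorem theorem7 (R : realType) (d : nat) (B1 B2 P S : 'M[R]_d)
    (hB1 : Hurwitz B1) (hB2 : Hurwitz B2)
    (hP : symmetric_posdef P)
    (hL1 : weak_Lyapunov P B1) (hL2 : weak_Lyapunov P B2)
    (hS : is_sqrtmx P S)
    (hK : Lyapunov_kernel S B1 `&` Lyapunov_kernel S B2 = [set 0])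
    (u : input R) :
  asymptotically_stable B1 B2 u.
Proof.
have [[ST S_gt0] SP] := hS.
have SK (x : 'cV[R]_d) : S *m x = 0 -> x = 0.
  move=> Sx; have [//|x0] := eqVneq x 0; have := S_gt0 _ x0.
  by rewrite /quad_form -mulmxA Sx mulmx0 mxE ltxx.
have Su : S \in unitmx.
  rewrite -row_free_unit; apply: inj_row_free => v /(congr1 trmx).
  rewrite trmx_mul ST trmx0 => /SK /(congr1 trmx).
  by rewrite trmxK trmx0.
(* The matrix defining the kernel is S^-1 (B^T P + P B) S^-1, and a nonnegative
   form vanishes only on the kernel of its symmetric matrix. *)
have kerL B (x : 'cV[R]_d) : weak_Lyapunov P B -> quad_form (lyap B P) x = 0 ->
    Lyapunov_kernel S B (S *m x).
  move=> hL Lx; rewrite /Lyapunov_kernel /ker_col /=.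
  have LT : (- lyap B P)^T = - lyap B P.
    rewrite /lyap linearN linearD /= !trmx_mul trmxK.
    by have [-> _] := hP; rewrite addrC.
  have L0 z : 0 <= quad_form (- lyap B P) z.
    by rewrite quad_formN oppr_ge0; exact: hL.
  have /eqP : - lyap B P *m x = 0.
    by apply: psd_null_ker LT L0 _; rewrite quad_formN Lx oppr0.
  rewrite mulNmx oppr_eq0 => /eqP Lx0.
  have -> : (S *m B *m invmx S)^T + S *m B *m invmx S
      = invmx S *m lyap B P *m invmx S.
    rewrite /lyap -SP !trmx_mul trmx_inv ST mulmxDr mulmxDl !mulmxA.
    by rewrite mulVmx// mul1mx -!mulmxA mulmxV// mulmx1.
  by rewrite -!mulmxA (mulmxA (invmx S) S) mulVmx// mul1mx Lx0 mulmx0.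
have null_trivial (x : 'cV[R]_d) :
    quad_form (lyap B1 P) x = 0 -> quad_form (lyap B2 P) x = 0 -> x = 0.
  move=> L1x L2x; apply: SK.
  have : (Lyapunov_kernel S B1 `&` Lyapunov_kernel S B2) (S *m x).
    by split; exact: kerL.
  by rewrite hK.
have [W [k [C [k0 C0 WC Wd]]]] :=
  exponential_Lyapunov hB1 hB2 (proj2 hP) hL1 hL2 null_trivial.
exact: (decay_asymptotically_stable u k0 WC Wd C0).
Qed.
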